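(* (a) For Baire 1 $f:[0,1]\to[0,1]$ given with its representation, the supremum $\sup_{x\in[p,q]}f(x)$ is computable in $\exists^2$ for any $p,q\in\mathbb{Q}\cap[0,1]$. (b) For Baire 1 $f:[0,1]\to\mathbb{R}$ given with its representation and $x\in[0,1]$, $\exists^2$ decides whether $x\in C_f$. (c) For Baire 1 $f:[0,1]\to\mathbb{R}$ given with its representation and $x\in[0,1]$, $\exists^2$ computes a modulus of continuity for $f$. (d) For effectively Baire 2 $f:[0,1]\to[0,1]$ given with its representation, the supremum $\sup_{x\in[p,q]}f(x)$ is computable in $\mathsf{S}^2$ for any $p,q\in\mathbb{Q}\cap[0,1]$. (e) For effectively Baire 2 $f:[0,1]\to[0,1]$ given with its representation and $x\in[0,1]$, $\mathsf{S}^2$ decides whether $x\in C_f$. (f) For effectively Baire 2 $f:[0,1]\to\mathbb{R}$ given with its representation, $\mathsf{S}^2$ computes a modulus of continuity for $f$.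
   Context: Computability is Kleene's S1-S9 computability for total objects of finite type over $\mathbb{N}$ (metatheory ZFC). The partial relation $\{e\}(\vec\Phi)\simeq y$ ($y\in\mathbb{N}$, $\vec\Phi$ a list of finite-type objects) is inductively generated by: S1 successor $x+1$; S2 constants; S3 projection to a number argument; S4 composition $\{e_1\}(\{e_2\}(\vec\Phi),\vec\Phi)$; S5 primitive recursion; S6 permutation of arguments; S7 $\{e\}(f,x,\vec\Phi)=f(x)$ for $f\in\mathbb{N}^{\mathbb{N}}$; S8 $\{e\}(\Psi^{n+2},\vec\Phi)=\Psi(\lambda\xi^{n}.\{e_1\}(\xi,\Psi,\vec\Phi))$ when the inner function is total; S9 $\{e\}(d,\vec\Phi,\vec\Phi')=\{d\}(\vec\Phi)$. A functional is computable in $G$ if, after currying so that values are natural numbers, it equals $\lambda\vec\Phi.\{e\}(G,\vec\Phi)$ for some index $e$. All items are uniform: there is a single functional computable in the named oracle that takes $f$, its representation, and the other listed data as inputs and returns the stated object. Real numbers are represented by fast-converging Cauchy sequences of rationals (elements of $\mathbb{N}^{\mathbb{N}}$); functions $\mathbb{R}\to\mathbb{R}$ are maps on representations respecting equality of reals, and functions on $[0,1]$ are treated likewise. $[p,q]$ presupposes $p\le q$. $\exists^2:\mathbb{N}^{\mathbb{N}}\to\{0,1\}$ satisfies $\exists^2(f)=0\leftrightarrow(\exists n)(f(n)=0)$. The Suslin functional $\mathsf{S}^2:\mathbb{N}^{\mathbb{N}}\to\{0,1\}$ satisfies $\mathsf{S}^2(f)=0\leftrightarrow(\exists g\in\mathbb{N}^{\mathbb{N}})(\forall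 n)(f(\overline{g}n)=0)$, with $\overline{g}n$ the code of $(g(0),\dots,g(n-1))$. $f:[0,1]\to\mathbb{R}$ is Baire 1 if it is the pointwise limit of a sequence of continuous functions on $[0,1]$; it is effectively Baire 2 if there is a double sequence $(f_{n,m})_{n,m\in\mathbb{N}}$ of continuous functions on $[0,1]$ with $f(x)=\lim_{n\to\infty}\lim_{m\to\infty}f_{n,m}(x)$ for all $x\in[0,1]$. These (double) sequences are called the representations of $f$. $C_f$ is the set of points of continuity of $f$. A modulus of continuity for $f$ (where it is assumed that $C_f\neq\emptyset$) is $F:(\mathbb{R}\times\mathbb{N})\to\mathbb{N}$ such that for all $k\in\mathbb{N}$, $x\in C_f$, $y\in[0,1]$: $|x-y|<\frac1{2^{F(x,k)}}\to|f(x)-f(y)|<\frac1{2^k}$. *)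

(* Defs.v *)
From mathcomp Require Import all_boot all_order all_algebra.
From mathcomp Require Import boolp classical_sets functions reals topology.
From mathcomp Require Import normedtype sequences.
Import Order.TTheory GRing.Theory Num.Theory numFieldNormedType.Exports.

Set Implicit Arguments.
Unset Strict Implicit.
Unset Printing Implicit Defensive.

(** * Finite types over the natural numbers *)

Inductive ty : Type := ty0 | Arr of ty & ty.

Declare Scope ty_scope.
Delimit Scope ty_scope with ty.
Bind Scope ty_scope with ty.
Notation "s ~> t" := (Arr s t)
  (at level 99, t at level 200, right associativity) : ty_scope.

Notation ty1 := (ty0 ~> ty0)%ty.
Notation ty2 := (ty1 ~> ty0)%ty.

(* The full type structure: all set-theoretic functions. *)
Fixpoint interp (s : ty) : Type :=
  match s with
  | ty0 => nat
  | Arr s t => interp s -> interp t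
  end.

Inductive obj : Type := Obj (s : ty) of interp s.

Definition num (n : nat) : obj := Obj (s := ty0) n.

(** * Kleene's schemes S1-S9 *)

(* [kleene e Phi y] is {e}(Phi) ~ y.  Indices are natural numbers, coded by
   the bijection [CodeSeq.code : seq nat -> nat].

   S8 is stated for an argument Psi of any type s1 ~> ... ~> sk ~> ty0, k >= 1,
   with one index per argument place:
     {<8, e1, ..., ek>}(Psi, Phi) ~ Psi (A1, ..., Ak),
     Ai := \xi. {ei}(xi, Psi, Phi)  of type si.
   When Psi has pure type n+2, this is the usual scheme
   Psi (\xi^n. {e1}(xi, Psi, Phi)).

   [denotes e Phi a] says that the total object a is \xi. {e}(xi, Phi); a tuple
   xi = (xi_1, ..., xi_m) is pushed one component at a time, hence stands in
   the argument list as xi_m, ..., xi_1.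
   [applies es Phi F y] says that F applied to the objects given by the indices
   es in Phi is y. *)
Inductive kleene : nat -> seq obj -> nat -> Prop :=
| S1 x Phi :
    kleene (CodeSeq.code [:: 1]) (num x :: Phi) x.+1
| S2 q Phi :
    kleene (CodeSeq.code [:: 2; q]) Phi q
| S3 x Phi :
    kleene (CodeSeq.code [:: 3]) (num x :: Phi) x
| S4 e1 e2 Phi z y :
    kleene e2 Phi z -> kleene e1 (num z :: Phi) y ->
    kleene (CodeSeq.code [:: 4; e1; e2]) Phi y
| S5_0 e1 e2 Phi y :
    kleene e1 Phi y ->
    kleene (CodeSeq.code [:: 5; e1; e2]) (num 0 :: Phi) y
| S5_S e1 e2 x Phi z y :
    kleene (CodeSeq.code [:: 5; e1; e2]) (num x :: Phi) z ->
    kleene e2 (num x :: num z :: Phi) y ->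
    kleene (CodeSeq.code [:: 5; e1; e2]) (num x.+1 :: Phi) y
| S6 (p : seq nat) e1 Phi y :
    perm_eq p (iota 0 (size Phi)) ->
    kleene e1 [seq nth (num 0) Phi i | i <- p] y ->
    kleene (CodeSeq.code [:: 6; CodeSeq.code p; e1]) Phi y
| S7 (f : interp ty1) x Phi :
    kleene (CodeSeq.code [:: 7]) (Obj (s := ty1) f :: num x :: Phi) (f x)
| S8 s t (Psi : interp (s ~> t)) es Phi y :
    applies es (Obj Psi :: Phi) Psi y ->
    kleene (CodeSeq.code (8 :: es)) (Obj Psi :: Phi) y
| S9 d Phi Phi' y :
    kleene d Phi y ->
    kleene (CodeSeq.code [:: 9; size Phi]) (num d :: Phi ++ Phi') y
with denotes : nat -> seq obj -> forall s : ty, interp s -> Prop :=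
| Lam0 e Phi y :
    kleene e Phi y -> denotes e Phi (s := ty0) y
| LamS e Phi s t (a : interp (s ~> t)) :
    (forall xi : interp s, denotes e (Obj xi :: Phi) (a xi)) ->
    denotes e Phi a
with applies : seq nat -> seq obj -> forall s : ty, interp s -> nat -> Prop :=
| App0 Phi (y : nat) :
    applies [::] Phi (s := ty0) y y
| AppS e es Phi s t (F : interp (s ~> t)) (a : interp s) y :
    denotes e Phi a -> applies es Phi (F a) y ->
    applies (e :: es) Phi F y.

(* A value h in N^N is computed by currying: its argument is the last input. *)
Definition computes1 (e : nat) (G : interp ty2) (Phi : seq obj)
    (h : nat -> nat) : Prop :=
  forall k, kleene e (Obj G :: rcons Phi (num k)) (h k).

(** * The functionals E^2 and S^2 *)

Definition E2 : interp ty2 :=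
  fun f : nat -> nat => if `[< exists n, f n = 0 >] then 0 else 1.

Definition initseg (g : nat -> nat) (n : nat) : nat := CodeSeq.code (mkseq g n).

Definition Suslin2 : interp ty2 :=
  fun f : nat -> nat =>
    if `[< exists g : nat -> nat, forall n, f (initseg g n) = 0 >]
    then 0 else 1.

Local Open Scope classical_set_scope.
Local Open Scope ring_scope.

(** * Representations of reals and of real functions *)

(* The code of a sequence starting with a, b, c denotes (a - b) / (c + 1);
   missing entries are 0.  Every rational has a code. *)
Definition ratc (n : nat) : rat :=
  let s := CodeSeq.decode n in
  (((nth 0%N s 0)%:Z - (nth 0%N s 1)%:Z)%:~R / ((nth 0%N s 2).+1)%:R)%R.

Definition fast_cauchy (x : nat -> nat) : Prop :=
  forall n i : nat, `|ratc (x n) - ratc (x (n + i)%N)| < 2 ^- n.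

Section Reals.
Variable R : realType.
Implicit Types (f : R -> R) (r : R).

Definition represents (x : nat -> nat) r : Prop :=
  fast_cauchy x /\ (ratr (ratc (x n)) : R) @[n --> \oo] --> r.

Definition I01 : set R := `[0, 1].

(* Functions on [0,1] are given by functions on R, of which only the values on
   [0,1] matter.  A functional F realizes some f iff it maps representations of
   points of [0,1] to representations of reals and respects equality of reals;
   the restriction of f to [0,1] is then determined by F. *)
Definition realizes (F : interp (ty1 ~> ty1)) f : Prop :=
  forall x r, I01 r -> represents x r -> represents (F x) (f r).

(** * Baire 1 and effectively Baire 2 functions, continuity *)

Definition baire1_by (u : nat -> R -> R) f : Prop :=
  (forall n, {within I01, continuous (u n)}) /\
  (forall r, I01 r -> u n r @[n --> \oo] --> f r).

Definition baire2_by (u : nat -> nat -> R -> R) f : Prop :=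
  (forall n m, {within I01, continuous (u n m)}) /\
  (forall r, I01 r -> exists l : nat -> R,
     (forall n, u n m r @[m --> \oo] --> l n) /\ l n @[n --> \oo] --> f r).

Definition baire1_rep (U : interp (ty0 ~> ty1 ~> ty1)) f : Prop :=
  exists u, baire1_by u f /\ forall n, realizes (U n) (u n).

Definition baire2_rep (U : interp (ty0 ~> ty0 ~> ty1 ~> ty1)) f : Prop :=
  exists u, baire2_by u f /\ forall n m, realizes (U n m) (u n m).

Definition cont_points f : set R :=
  [set r | I01 r /\ f r' @[r' --> within I01 (nbhs r)] --> f r].

Definition modulus f (M : R -> nat -> nat) : Prop :=
  forall k r y, cont_points f r -> I01 y ->
    `|r - y| < 2 ^- M r k -> `|f r - f y| < 2 ^- k.

Definition sup_on f (p q : rat) : R := sup (f @` `[ratr p, ratr q]).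

(** * Computability of the supremum, of C_f and of a modulus

   f ranges over D; T is the type of the representations U of f and rep says
   which objects of type T represent f.  In each case the index e is uniform in
   f (given by F), U and the remaining data. *)

Section Tasks.
Variables (G : interp ty2) (T : ty) (rep : interp T -> (R -> R) -> Prop).
Variable D : set (R -> R).

Definition sup_computable : Prop :=
  exists e : nat, forall f (F : interp (ty1 ~> ty1)) (U : interp T),
    D f -> realizes F f -> rep U f ->
    forall p q : nat, 0 <= ratc p -> ratc p <= ratc q -> ratc q <= 1 ->
    exists h : nat -> nat,
      computes1 e G [:: Obj F; Obj U; num p; num q] h /\
      represents h (sup_on f (ratc p) (ratc q)).

Definition continuity_decidable : Prop :=
  exists e : nat, forall f (F : interp (ty1 ~> ty1)) (U : interp T),
    D f -> realizes F f -> rep U f ->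
    forall (x : nat -> nat) r, I01 r -> represents x r ->
      kleene e [:: Obj G; Obj F; Obj U; Obj (s := ty1) x]
        (if `[< cont_points f r >] then 1%N else 0%N).

(* The modulus is a function on R x N: as computed on representations, it
   respects equality of reals. *)
Definition modulus_computable : Prop :=
  exists e : nat, forall f (F : interp (ty1 ~> ty1)) (U : interp T),
    D f -> realizes F f -> rep U f -> cont_points f !=set0 ->
    exists M : R -> nat -> nat, modulus f M /\
      forall (x : nat -> nat) r, represents x r ->
        computes1 e G [:: Obj F; Obj U; Obj (s := ty1) x] (M r).

End Tasks.

Definition I01_valued : set (R -> R) := [set f | forall r, I01 r -> I01 (f r)].

End Reals.

(* Main.v *)
Require Import Defs.
From mathcomp Require Import all_boot all_order all_algebra.
From mathcomp Require Import boolp classical_sets functions reals topology.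
From mathcomp Require Import normedtype sequences.
From mathcomp Require Import zify ring lra.
Import Order.TTheory GRing.Theory Num.Theory numFieldNormedType.Exports.

Set Implicit Arguments.
Unset Strict Implicit.
Unset Printing Implicit Defensive.

(** Every item reduces to one query: does f, or -f, take a value above a rational
b between two rationals p and q?  The supremum is then approximated by a search
for a rational at which the answers change.  Continuity of f at x says that for
each k some rational interval around x is mapped into a rational interval of
length 2^-(k+1).  This is a statement about queries and about comparisons of x
with rationals, with number quantifiers only; a modulus at x and k is the least
N such that the ball of radius 2^-N around x lies in such an interval
([oscillation]).

For f the limit of continuous u_n, the query is arithmetical.  That f(y) > b
means that u_n(y) >= b + 2^-e for all n >= N, for some e and N.  For fixed e and
N these are closed conditions on y, so by compactness ([compactness]) they can
be met together as soon as any finitely many of them can be met up to an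
arbitrarily small error, and then by a rational y.  Values of u_n at rationals
are read off the representation, so E2 answers the query ([exceeds1P]).

For a double limit of u_(n,m), one more object is needed: a function h such that
u_(n,m)(y) >= b + 2^-e whenever n >= N and m >= h(n).  The same compactness
argument eliminates the real y, and what remains is an existential quantifier
over h in front of conditions on the initial segments of h, which is what the
Suslin functional decides ([exceeds2P]).

On the side of computability, an index uniform in some parameters is built for
each formula by following its shape.  The lemmas that carry this are the search
obtained from S9 ([kleene_search]), the closure of decidable relations under
number quantifiers ([dec_ex]), which for the Suslin functional goes through a
reduction of E2 to it ([Suslin2_E2]), and the representation of rationals by
triples of numbers ([rcomputable]). *)

(** * Rearranging the arguments of a computation *)

Definition tr (i j k : nat) := if k == i then j else if k == j then i else k.

Definition swap i j (Phi : seq obj) :=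
  mkseq (fun k => nth (num 0) Phi (tr i j k)) (size Phi).

Lemma size_swap i j Phi : size (swap i j Phi) = size Phi.
Proof. exact: size_mkseq. Qed.

Lemma trK i j : involutive (tr i j).
Proof. by move=> k; rewrite /tr; do !case: eqP => //; lia. Qed.

Lemma tr_lt n i j k : i < n -> j < n -> k < n -> tr i j k < n.
Proof. by rewrite /tr; do !case: eqP. Qed.

Lemma swapK i j Phi : i < size Phi -> j < size Phi ->
  swap i j (swap i j Phi) = Phi.
Proof.
move=> hi hj; apply: (@eq_from_nth _ (num 0)); first by rewrite !size_swap.
move=> k; rewrite !size_swap => hk.
by rewrite !nth_mkseq ?size_swap ?tr_lt// trK.
Qed.

Lemma swap_head i Phi : i < size Phi ->
  swap 0 i Phi = nth (num 0) Phi i :: behead (swap 0 i Phi).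
Proof. by case: Phi => // a l _; rewrite /swap /mkseq /= . Qed.

Lemma swap_cons i j x Phi : x :: swap i j Phi = swap i.+1 j.+1 (x :: Phi).
Proof.
rewrite /swap /mkseq /= {2}/tr /=; congr cons.
rewrite -[in RHS](addn0 1) iotaDl -map_comp; apply: eq_map => k /=.
rewrite /tr add1n !eqSS.
by do !case: eqP.
Qed.

(** S6 with the transposition of two argument places; one index serves all
argument lists of a given length, as S6 needs the length. *)
Lemma kleene_swap n i j e : i < n -> j < n -> exists e', forall Phi y,
  size Phi = n -> kleene e (swap i j Phi) y -> kleene e' Phi y.
Proof.
move=> hi hj.
exists (CodeSeq.code [:: 6; CodeSeq.code [seq tr i j k | k <- iota 0 n]; e]).
move=> Phi y hn h; apply: S6; last by rewrite -map_comp -hn.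
rewrite hn; apply: uniq_perm.
- by rewrite map_inj_uniq ?iota_uniq//; apply/can_inj/trK.
- exact: iota_uniq.
- move=> k; rewrite mem_iota add0n /=; apply/mapP/idP.
    by move=> [l]; rewrite mem_iota => /andP[_ hl] ->; apply: tr_lt.
  move=> hk; exists (tr i j k); last by rewrite trK.
  by rewrite mem_iota/= tr_lt.
Qed.

(** S9 ignores trailing arguments, so the head is first permuted to the end;
the index to be run is pushed as a constant. *)
Lemma kleene_drop0 n e : exists e', forall x Phi y,
  size Phi = n -> kleene e Phi y -> kleene e' (x :: Phi) y.
Proof.
exists (CodeSeq.code [:: 6; CodeSeq.code (rcons (iota 1 n) 0);
   CodeSeq.code [:: 4; CodeSeq.code [:: 9; n]; CodeSeq.code [:: 2; e]]]).
move=> x Phi y hn h; apply: S6.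
  by rewrite /= hn perm_rcons.
have -> : [seq nth (num 0) (x :: Phi) i | i <- rcons (iota 1 n) 0] = Phi ++ [:: x].
  rewrite map_rcons /= -cats1 -(addn0 1) iotaDl -map_comp.
  by congr (_ ++ _); rewrite -hn; apply: mkseq_nth.
apply: S4; first exact: S2.
by rewrite -hn; apply: S9.
Qed.

Lemma kleene_drop1 n e : exists e', forall x z Phi y,
  size Phi = n -> kleene e (x :: Phi) y -> kleene e' (x :: z :: Phi) y.
Proof.
have [e1 h1] := kleene_drop0 n.+1 e.
have [//|//|e2 h2] := @kleene_swap n.+2 0 1 e1.
exists e2 => x z Phi y hn h; apply: h2; first by rewrite /= hn.
rewrite -/(swap 0 1 _).
have -> : swap 0 1 (x :: z :: Phi) = z :: x :: Phi.
  rewrite /swap /mkseq /= /tr /=; congr [:: _, _ & _].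
  rewrite -(addn0 2) iotaDl -map_comp; apply: mkseq_nth.
by apply: h1 => //=; rewrite hn.
Qed.

(** * Unbounded search *)

Lemma kleene_num1 n : exists e, forall d x Phi,
  size Phi = n -> kleene e (d :: num x :: Phi) x.
Proof.
have [e h] := kleene_drop0 n.+1 (CodeSeq.code [:: 3]).
by exists e => d x Phi hn; apply: h; [rewrite /= hn|apply: S3].
Qed.

(** Minimization is not a scheme: it needs the reflection of indices in S9.
Instead of the recursion theorem, the step function takes its own index as an
argument and is started on itself. *)
Lemma kleene_search n s : exists e, forall Phi (P : pred nat) (k : nat),
  size Phi = n -> (forall m, kleene s (num m :: Phi) (P m)) ->
  P k -> (forall m, m < k -> ~~ P m) -> kleene e Phi k.
Proof.
(* the state is (m, d, Phi), with d an index of the search itself *)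
have [test htest] := kleene_drop1 n s.
have [next hnext] : exists next, forall m d Phi y, size Phi = n ->
    kleene d (num m.+1 :: num d :: Phi) y ->
    kleene next (num m :: num d :: Phi) y.
  have [p hp] := kleene_num1 n.
  have [e1 h1] := kleene_drop1 n.+1 (CodeSeq.code [:: 4; CodeSeq.code [:: 9; n.+2]; p]).
  exists (CodeSeq.code [:: 4; e1; CodeSeq.code [:: 1]]) => m d Phi y hn h.
  apply: S4; first exact: S1.
  apply: h1; first by rewrite /= hn.
  apply: S4; first exact: hp.
  by have := S9 [::] h; rewrite cats0 /= hn.
(* S5 evaluates both of its branches, and the recursive call may only be made
   when the test fails: so S5 selects an index, which S9 then runs *)
pose branch := CodeSeq.code [:: 5; CodeSeq.code [:: 2; next];
                                   CodeSeq.code [:: 2; CodeSeq.code [:: 3]]].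
pose step := CodeSeq.code [:: 4; CodeSeq.code [:: 9; n.+2];
                              CodeSeq.code [:: 4; branch; test]].
exists (CodeSeq.code [:: 4; CodeSeq.code [:: 4; step; CodeSeq.code [:: 2; 0]];
                         CodeSeq.code [:: 2; step]]) => Phi P k hn hs hk hmin.
apply: S4; first exact: S2.
apply: S4; first exact: S2.
suff H j m : m + j = k -> kleene step (num m :: num step :: Phi) k.
  exact: (H k).
elim: j m => [|j IH] m hm.
  have {}hm : m = k by lia.
  subst m.
  apply: (@S4 _ _ _ (CodeSeq.code [:: 3])).
    apply: S4; first by apply: htest => //; apply: hs.
    rewrite hk; apply: S5_S; last exact: S2.
    by apply: S5_0; apply: S2.
  have := @S9 (CodeSeq.code [:: 3]) (num k :: num step :: Phi) [::] k.
  by rewrite cats0 /= hn; apply; apply: S3.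
apply: (@S4 _ _ _ next).
  apply: S4; first by apply: htest => //; apply: hs.
  have /negbTE -> : ~~ P m by apply: hmin; lia.
  by apply: S5_0; apply: S2.
have := @S9 next (num m :: num step :: Phi) [::] k.
rewrite cats0 /= hn; apply; apply: hnext => //.
by apply: IH; lia.
Qed.

(** * Functions computable uniformly in parameters *)

(** The parameters a over which an index has to be uniform, with the argument
list that they give rise to.  The length is constant because S6 and S9 refer to
it. *)
Record ctx := Ctx {
  car :> Type;
  objs : car -> seq obj;
  len : nat;
  size_objs : forall a, size (objs a) = len }.

Implicit Types c : ctx.

Arguments objs : clear implicits.

Lemma size_ext c (p : c * nat) : size (num p.2 :: objs c p.1) = (len c).+1.
Proof. by rewrite /= size_objs. Qed.

(** A bound number variable, the innermost one being the head of the argument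
list. *)
Definition ext (c : ctx) : ctx := Ctx (@size_ext c).

Definition computable (c : ctx) (f : c -> nat) :=
  exists e, forall a, kleene e (objs c a) (f a).

Definition carries (c : ctx) (s : ty) (F : c -> interp s) :=
  exists2 i, i < len c & forall a, nth (num 0) (objs c a) i = Obj (F a).

Lemma carries_weak c s (F : c -> interp s) :
  carries F -> carries (c := ext c) (fun p => F p.1).
Proof. by move=> [i hi h]; exists i.+1; [exact: hi|move=> p; exact: h]. Qed.

Lemma comp_weak c (f : c -> nat) :
  computable f -> computable (c := ext c) (fun p => f p.1).
Proof.
move=> [e h]; have [e' h'] := kleene_drop0 (len c) e.
by exists e' => p; apply: h' => //; exact: size_objs.
Qed.

Lemma comp_var c : computable (c := ext c) (fun p => p.2).
Proof. by exists (CodeSeq.code [:: 3]) => p; apply: S3. Qed.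

Lemma comp_under c (f : c -> nat -> nat) :
  computable (c := ext c) (fun p => f p.1 p.2) ->
  computable (c := ext (ext c)) (fun p => f p.1.1 p.2).
Proof.
move=> [e h]; have [e' h'] := kleene_drop1 (len c) e; exists e' => -[[a n] m].
by apply: h' (h (a, m)); exact: size_objs.
Qed.

Lemma comp_const c q : computable (c := c) (fun=> q).
Proof. by exists (CodeSeq.code [:: 2; q]) => a; apply: S2. Qed.

Lemma comp_let c (f : c -> nat -> nat) (g : c -> nat) :
  computable (c := ext c) (fun p => f p.1 p.2) -> computable g ->
  computable (fun a => f a (g a)).
Proof.
move=> [e1 h1] [e2 h2]; exists (CodeSeq.code [:: 4; e1; e2]) => a.
by apply: S4; [apply: h2|apply: (h1 (a, g a))].
Qed.

Lemma comp_num c (f : c -> nat) : carries (s := ty0) f -> computable f.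
Proof.
move=> [i hi h].
have [e he] := kleene_swap (CodeSeq.code [:: 3]) (leq_ltn_trans (leq0n i) hi) hi.
exists e => a; apply: he; first exact: size_objs.
rewrite swap_head ?size_objs// h; exact: S3.
Qed.

Lemma comp_rec c (f0 g : c -> nat) (f2 : c -> nat -> nat -> nat) :
  computable f0 ->
  computable (c := ext (ext c)) (fun p => f2 p.1.1 p.2 p.1.2) ->
  computable g ->
  computable (fun a => nat_rec (fun=> nat) (f0 a) (fun x z => f2 a x z) (g a)).
Proof.
move=> [e0 h0] [e2 h2].
apply: (@comp_let _ (fun a x => nat_rec (fun=> nat) (f0 a) _ x)).
exists (CodeSeq.code [:: 5; e0; e2]) => -[a n] /=.
elim: n => [|n IH] /=; first exact: S5_0.
by apply: S5_S IH _; apply: (h2 ((a, _), n)).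
Qed.

Lemma comp_succ c (f : c -> nat) : computable f -> computable (fun a => (f a).+1).
Proof.
apply: (@comp_let _ (fun _ n => n.+1)).
by exists (CodeSeq.code [:: 1]) => p; apply: S1.
Qed.

(** * Applying an oracle *)

(** S8 expects the oracle at the head, where a transposition brings it; the
indices for its arguments must undo that transposition, below the variable of
an argument that is itself a function. *)
Lemma arg0 c i (f : c -> nat) : 0 < len c -> i < len c -> computable f ->
  exists e, forall a, denotes e (swap 0 i (objs c a)) (f a : interp ty0).
Proof.
move=> h0 hi [e h]; have [e' h'] := kleene_swap e h0 hi.
exists e' => a; apply/Lam0/h'; first by rewrite size_swap size_objs.
by rewrite swapK ?size_objs.
Qed.

Lemma arg1 c i (f : c -> nat -> nat) : 0 < len c -> i < len c ->
  computable (c := ext c) (fun p => f p.1 p.2) ->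
  exists e, forall a, denotes e (swap 0 i (objs c a)) (f a : interp ty1).
Proof.
move=> h0 hi [e h].
have [//|//|e' h'] := @kleene_swap (len c).+1 1 i.+1 e.
exists e' => a; apply: LamS => n; apply/Lam0/h'.
  by rewrite /= size_swap size_objs.
rewrite swap_cons swapK /= ?size_objs//.
exact: (h (a, n)).
Qed.

Lemma comp_S8 c s t (F : c -> interp (s ~> t)) i es y :
  i < len c -> (forall a, nth (num 0) (objs c a) i = Obj (F a)) ->
  (forall a, applies es (swap 0 i (objs c a)) (F a) (y a)) ->
  computable y.
Proof.
move=> hi hF hy.
have [e he] := kleene_swap (CodeSeq.code (8 :: es)) (leq_ltn_trans (leq0n i) hi) hi.
exists e => a; apply: he; first exact: size_objs.
move: (hy a); rewrite swap_head ?size_objs// hF => h.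
exact: S8.
Qed.

Lemma comp_ap1 c (F : c -> interp ty1) (n : c -> nat) :
  carries F -> computable n -> computable (fun a => F a (n a)).
Proof.
move=> [i hi hF] cn; have h0 := leq_ltn_trans (leq0n i) hi.
have [e1 h1] := arg0 h0 hi cn.
apply: (comp_S8 (es := [:: e1]) hi hF) => a.
by apply: AppS (h1 a) _; apply: App0.
Qed.

Lemma comp_ap2 c (F : c -> interp ty2) (x : c -> nat -> nat) :
  carries F -> computable (c := ext c) (fun p => x p.1 p.2) ->
  computable (fun a => F a (x a)).
Proof.
move=> [i hi hF] cx; have h0 := leq_ltn_trans (leq0n i) hi.
have [e1 h1] := arg1 h0 hi cx.
apply: (comp_S8 (es := [:: e1]) hi hF) => a.
by apply: AppS (h1 a) _; apply: App0.
Qed.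

Lemma comp_seq1 c (F : c -> interp (ty0 ~> ty1 ~> ty1)) (n k : c -> nat)
    (x : c -> nat -> nat) :
  carries F -> computable n -> computable (c := ext c) (fun p => x p.1 p.2) ->
  computable k -> computable (fun a => F a (n a) (x a) (k a)).
Proof.
move=> [i hi hF] cn cx ck; have h0 := leq_ltn_trans (leq0n i) hi.
have [en hn] := arg0 h0 hi cn; have [ex hx] := arg1 h0 hi cx.
have [ek hk] := arg0 h0 hi ck.
apply: (comp_S8 (es := [:: en; ex; ek]) hi hF) => a.
apply: AppS (hn a) _; apply: AppS (hx a) _; apply: AppS (hk a) _.
exact: App0.
Qed.

Lemma comp_seq2 c (F : c -> interp (ty0 ~> ty0 ~> ty1 ~> ty1))
    (n m k : c -> nat) (x : c -> nat -> nat) :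
  carries F -> computable n -> computable m ->
  computable (c := ext c) (fun p => x p.1 p.2) ->
  computable k -> computable (fun a => F a (n a) (m a) (x a) (k a)).
Proof.
move=> [i hi hF] cn cm cx ck; have h0 := leq_ltn_trans (leq0n i) hi.
have [en hn] := arg0 h0 hi cn; have [ex hx] := arg1 h0 hi cx.
have [ek hk] := arg0 h0 hi ck; have [em hm] := arg0 h0 hi cm.
apply: (comp_S8 (es := [:: en; em; ex; ek]) hi hF) => a.
apply: AppS (hn a) _; apply: AppS (hm a) _; apply: AppS (hx a) _.
by apply: AppS (hk a) _; apply: App0.
Qed.

(** * Arithmetic *)

Lemma comp_eq c (f g : c -> nat) : computable f -> (forall a, f a = g a) -> computable g.
Proof. by move=> cf /funext <-. Qed.

Lemma comp_pred c (f : c -> nat) : computable f -> computable (fun a => (f a).-1).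
Proof.
move=> cf; apply: comp_eq.
  apply: (comp_rec (f0 := fun=> 0) (f2 := fun _ n _ => n) (g := f)) => //.
  - exact: comp_const.
  - exact: comp_var.
by move=> a /=; case: (f a).
Qed.

Lemma comp_add c (f g : c -> nat) :
  computable f -> computable g -> computable (fun a => f a + g a).
Proof.
move=> cf cg; apply: comp_eq.
  apply: (comp_rec (f0 := g) (f2 := fun _ _ z => z.+1) (g := f)) => //.
  exact/comp_succ/(comp_weak (comp_var _)).
by move=> a /=; elim: (f a) => //= n ->.
Qed.

Lemma comp_mul c (f g : c -> nat) :
  computable f -> computable g -> computable (fun a => f a * g a).
Proof.
move=> cf cg; apply: comp_eq.
  apply: (comp_rec (f0 := fun=> 0) (f2 := fun a _ z => g a + z) (g := f)) => //.
    exact: comp_const.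
  by apply: comp_add; [exact/(comp_weak (comp_weak cg))|exact/(comp_weak (comp_var _))].
by move=> a /=; elim: (f a) => //= n ->; rewrite mulSn.
Qed.

Lemma comp_sub c (f g : c -> nat) :
  computable f -> computable g -> computable (fun a => f a - g a).
Proof.
move=> cf cg; apply: comp_eq.
  apply: (comp_rec (f0 := f) (f2 := fun a _ z => z.-1) (g := g)) => //.
  exact/comp_pred/(comp_weak (comp_var _)).
by move=> a /=; elim: (g a) => //= [|n ->]; lia.
Qed.

Lemma comp_exp2 c (f : c -> nat) : computable f -> computable (fun a => 2 ^ f a).
Proof.
move=> cf; apply: comp_eq.
  apply: (comp_rec (f0 := fun=> 1) (f2 := fun _ _ z => 2 * z) (g := f)) => //.
    exact: comp_const.
  by apply: comp_mul; [exact: comp_const|exact/(comp_weak (comp_var _))].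
by move=> a /=; elim: (f a) => //= n ->; rewrite expnS.
Qed.

(** * Decidable relations *)

Definition dec (c : ctx) (P : c -> Prop) :=
  computable (fun a => if `[< P a >] then 1 else 0).

Lemma dec_iff c (P Q : c -> Prop) : dec P -> (forall a, P a <-> Q a) -> dec Q.
Proof. by move=> dP PQ; have -> : Q = P by apply/predeqP => a; split=> /PQ. Qed.

Lemma dec_weak c (P : c -> Prop) : dec P -> dec (c := ext c) (fun p => P p.1).
Proof. exact: comp_weak. Qed.

Lemma dec_const c (P : Prop) : dec (c := c) (fun=> P).
Proof. exact: comp_const. Qed.

Lemma dec_and c (P Q : c -> Prop) : dec P -> dec Q -> dec (fun a => P a /\ Q a).
Proof.
move=> dP dQ; apply: comp_eq; first exact: (comp_mul dP dQ).
by move=> a /=; do 3!case: asboolP; tauto.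
Qed.

Lemma dec_not c (P : c -> Prop) : dec P -> dec (fun a => ~ P a).
Proof.
move=> dP; apply: comp_eq; first exact: (comp_sub (comp_const _ 1) dP).
by move=> a /=; do 2!case: asboolP; tauto.
Qed.

Lemma dec_or c (P Q : c -> Prop) : dec P -> dec Q -> dec (fun a => P a \/ Q a).
Proof.
move=> dP dQ; apply: dec_iff; first exact: (dec_not (dec_and (dec_not dP) (dec_not dQ))).
by move=> a /=; have [] := (EM (P a), EM (Q a)); tauto.
Qed.

Lemma dec_imp c (P Q : c -> Prop) : dec P -> dec Q -> dec (fun a => P a -> Q a).
Proof.
move=> dP dQ; apply: dec_iff; first exact: (dec_or (dec_not dP) dQ).
by move=> a /=; have := EM (P a); tauto.
Qed.

Lemma dec_eq0 c (f : c -> nat) : computable f -> dec (fun a => f a = 0).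
Proof.
move=> cf; apply: comp_eq; first exact: (comp_sub (comp_const _ 1) cf).
by move=> a /=; case: asboolP; lia.
Qed.

Lemma dec_leq c (f g : c -> nat) :
  computable f -> computable g -> dec (fun a => f a <= g a).
Proof.
move=> cf cg; apply: dec_iff; first exact/dec_eq0/(comp_sub cf cg).
by move=> a; lia.
Qed.

Lemma dec_eqn c (f g : c -> nat) :
  computable f -> computable g -> dec (fun a => f a = g a).
Proof.
move=> cf cg; apply: dec_iff.
  exact: (dec_and (dec_leq cf cg) (dec_leq cg cf)).
by move=> a /=; lia.
Qed.

(** * The two jump functionals *)

(** A zero k of f is found below the code of any nonempty initial segment of the
constant sequence k.  Only a bounded product is needed, hence only primitive
recursion: decoding of sequences comes later, from minimization. *)
Lemma Suslin2_E2 (f : nat -> nat) :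
  E2 f = Suslin2 (fun s => nat_rec (fun=> nat) 0
     (fun n _ => nat_rec (fun=> nat) 1 (fun k z => f k * z) n.+1) s).
Proof.
have key n : nat_rec (fun=> nat) 1 (fun k z => f k * z) n = 0 <->
    exists2 k, k < n & f k = 0.
  elim: n => [|n IH] /=; first by split=> // -[].
  rewrite (rwP eqP) muln_eq0; split.
    move=> /orP[/eqP h|/eqP/IH[k kn fk]]; first by exists n.
    by exists k => //; lia.
  move=> [k]; rewrite ltnS leq_eqVlt => /orP[/eqP -> ->//|kn fk].
  by apply/orP; right; apply/eqP/IH; exists k.
rewrite /E2 /Suslin2; congr (if _ then _ else _); apply: asbool_equiv_eq; split.
  move=> [k fk]; exists (fun=> k) => -[//|n].
  have /allP/(_ k) := CodeSeq.ltn_code (mkseq (fun=> k) n.+1).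
  rewrite -/(initseg _ _) in_cons eqxx => /(_ isT); case: initseg => // m km.
  by apply: (proj2 (key m.+1)); exists k.
move=> [g /(_ 1)]; have : 0 < initseg g 1 by rewrite /initseg /= muln_gt0 expn_gt0.
by case: initseg => // n _ /(proj1 (key n.+1))[k _ fk]; exists k.
Qed.

Definition jumps (G : interp ty2) := G = E2 \/ G = Suslin2.

Lemma comp_E2 c G (f : c -> nat -> nat) : jumps G -> carries (s := ty2) (fun _ : c => G) ->
  computable (c := ext c) (fun p => f p.1 p.2) -> computable (fun a => E2 (f a)).
Proof.
move=> jG hG cf; case: jG => GE; first by rewrite -GE; apply: (comp_ap2 (F := fun=> G)).
rewrite (funext (fun a => Suslin2_E2 (f a))) -GE; apply: (comp_ap2 (F := fun=> G)) => //.
apply: comp_rec; [exact: comp_const| |exact: comp_var].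
apply: comp_rec; [exact: comp_const| |apply: comp_succ; exact: comp_var].
apply: comp_mul; last exact: (comp_weak (comp_var _)).
apply: (@comp_under (ext (ext (ext c))) (fun q => f q.1.1.1)).
apply: (@comp_under (ext (ext c)) (fun q => f q.1.1)).
apply: (@comp_under (ext c) (fun q => f q.1)).
exact: comp_under.
Qed.

(** * Quantifiers and minimization *)

Definition least (P : nat -> Prop) : nat :=
  if pselect (exists n, `[< P n >]) is left h then ex_minn h else 0.

Lemma leastP (P : nat -> Prop) n : P n -> P (least P).
Proof.
move=> Pn; rewrite /least; case: pselect => [h|[]]; last by exists n; apply/asboolP.
by case: ex_minnP => m /asboolP.
Qed.

(** All that number quantifiers and minimization need, whichever of the two
functionals is the oracle. *)
Definition carries_jump c := exists2 G, jumps G & carries (s := ty2) (fun _ : c => G).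

Lemma jump_weak c : carries_jump c -> carries_jump (ext c).
Proof. by move=> [G jG hG]; exists G => //; apply: (carries_weak (F := fun=> G)). Qed.

Lemma dec_ex c (P : c -> nat -> Prop) : carries_jump c ->
  dec (c := ext c) (fun p => P p.1 p.2) -> dec (fun a => exists n, P a n).
Proof.
move=> [G jG hG] dP; have := comp_E2 (f := fun a n => if `[< ~ P a n >] then 1 else 0).
move=> /(_ _ jG hG (dec_not dP)) cE.
apply: dec_iff; first exact: (dec_eq0 cE).
move=> a /=; rewrite /E2; case: asboolP => h; split=> //.
- by move=> _; move: h => [n]; case: asboolP => // /contrapT Pn _; exists n.
- by move=> [n Pn]; exfalso; apply: h; exists n; case: asboolP.
Qed.

Lemma dec_all c (P : c -> nat -> Prop) : carries_jump c ->
  dec (c := ext c) (fun p => P p.1 p.2) -> dec (fun a => forall n, P a n).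
Proof.
move=> hG dP; apply: dec_iff.
  exact: (dec_not (dec_ex (P := fun a n => ~ P a n) hG (dec_not dP))).
move=> a /=; split=> [h n|h [n]]; last exact.
by apply: contrapT => nP; apply: h; exists n.
Qed.

Lemma comp_least c (P : c -> nat -> Prop) : carries_jump c ->
  dec (c := ext c) (fun p => P p.1 p.2) -> computable (fun a => least (P a)).
Proof.
move=> hG dP.
(* true everywhere when P has no solution, so that the search always stops *)
pose Q a n := P a n \/ ~ exists m, P a m.
have [s hs] : dec (c := ext c) (fun p => Q p.1 p.2).
  by apply: dec_or => //; apply: dec_not; apply: (dec_weak (dec_ex hG dP)).
have [e he] := kleene_search (len c) s.
exists e => a; apply: (he (objs c a) (fun n => `[< Q a n >])).
- exact: size_objs.
- by move=> m; have := hs (a, m); case: asboolP.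
- rewrite /least; case: pselect => [h|h].
    by case: ex_minnP => m /asboolP Pm _; apply/asboolP; left.
  by apply/asboolP; right => -[n Pn]; apply: h; exists n; apply/asboolP.
- move=> m; rewrite /least; case: pselect => // h.
  case: ex_minnP => k /asboolP Pk kmin mk; apply/negP => /asboolP[Pm|[]]; last by exists k.
  by have := kmin m (asboolT Pm); rewrite leqNgt mk.
Qed.

Lemma dec_Suslin c (P : c -> nat -> Prop) : carries (s := ty2) (fun _ : c => Suslin2) ->
  dec (c := ext c) (fun p => P p.1 p.2) ->
  dec (fun a => exists g : nat -> nat, forall n, P a (initseg g n)).
Proof.
move=> hS dP.
have := comp_ap2 (x := fun a n => if `[< ~ P a n >] then 1 else 0) hS (dec_not dP).
move=> /dec_eq0 /dec_iff; apply => a /=; rewrite /Suslin2; split.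
  case: asboolP => // -[g h] _; exists g => n; apply: contrapT => nP.
  by move: (h n); case: asboolP.
by move=> [g h]; case: asboolP => // -[]; exists g => n; case: asboolP => // -[].
Qed.

(** * Sequence codes *)

Definition nthc s i := nth 0 (CodeSeq.decode s) i.
Definition sizec s := size (CodeSeq.decode s).

(* The tactics below read a program off the shape of a formula.  [leaf] weakens
   what is known of the parameters to the bound variables in force. *)
Ltac leaf := first [ assumption | exact: comp_const | exact: comp_var | exact: dec_const
  | refine (carries_weak (F := _) _); leaf
  | refine (jump_weak _); leaf
  | refine (comp_weak (f := _) _); leaf
  | refine (dec_weak (P := _) _); leaf ].

Ltac comp_step := first
  [ leaf
  | apply: dec_and | apply: dec_or | apply: dec_imp | apply: dec_not
  | apply: dec_ex | apply: dec_all | apply: dec_leq | apply: dec_eqn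
  | apply: comp_succ | apply: comp_pred | apply: comp_add | apply: comp_mul
  | apply: comp_sub | apply: comp_exp2 | apply: comp_least ].

Ltac comp := repeat comp_step.

Lemma code_cons v s : CodeSeq.code (v :: s) = 2 ^ v * (2 * CodeSeq.code s + 1).
Proof. by rewrite addn1 mul2n. Qed.

Lemma decode_cons v b : CodeSeq.decode (2 ^ v * (2 * b + 1)) = v :: CodeSeq.decode b.
Proof. by rewrite -{1}(CodeSeq.decodeK b) -code_cons CodeSeq.codeK. Qed.

Lemma code_case s : s = 0 \/ exists v b, s = 2 ^ v * (2 * b + 1).
Proof.
case: (CodeSeq.decode s) (CodeSeq.decodeK s) => [|v b] <-; first by left.
by right; exists v, (CodeSeq.code b); rewrite code_cons.
Qed.

(** A nonzero code is 2^v (2b + 1) for its head v and the code b of its tail: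
minimization finds both. *)
Lemma comp_head c (f : c -> nat) : carries_jump c -> computable f ->
  computable (fun a => nthc (f a) 0).
Proof.
move=> hG cf; apply: (comp_let (f := fun _ s => nthc s 0)) => //.
pose P s v := s = 0 /\ v = 0 \/ exists b, s = 2 ^ v * (2 * b + 1).
apply: (@comp_eq (ext c) (fun p => least (P p.2))).
  by rewrite /P; comp.
move=> [_ s] /=; have : P s (nthc s 0).
  case: (code_case s) => [->|[v [b ->]]]; first by left.
  by right; rewrite /nthc decode_cons; exists b.
move=> /leastP; case=> [[-> ->]//|[b {2}->]].
by rewrite /nthc decode_cons.
Qed.

Definition tailc s := CodeSeq.code (behead (CodeSeq.decode s)).

Lemma comp_tail c (f : c -> nat) : carries_jump c -> computable f ->
  computable (fun a => tailc (f a)).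
Proof.
move=> hG cf; apply: (comp_let (f := fun _ s => tailc s)) => //.
pose P s b := s = 0 /\ b = 0 \/ exists v, s = 2 ^ v * (2 * b + 1).
apply: (@comp_eq (ext c) (fun p => least (P p.2))).
  by rewrite /P; comp.
move=> [_ s] /=; have : P s (tailc s).
  case: (code_case s) => [->|[v [b ->]]]; first by left.
  by right; rewrite /tailc decode_cons CodeSeq.decodeK; exists v.
move=> /leastP; case=> [[-> ->]//|[b {2}->]].
by rewrite /tailc decode_cons CodeSeq.decodeK.
Qed.

Definition dropc s n := CodeSeq.code (drop n (CodeSeq.decode s)).

Lemma comp_drop c (f g : c -> nat) : carries_jump c ->
  computable f -> computable g -> computable (fun a => dropc (f a) (g a)).
Proof.
move=> hG cf cg.
have E a n : nat_rec (fun=> nat) (f a) (fun _ z => tailc z) n = dropc (f a) n.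
  elim: n => [|n IH]; first by rewrite /dropc drop0 CodeSeq.decodeK.
  transitivity (tailc (dropc (f a) n)); first by rewrite -IH.
  by rewrite /dropc /tailc CodeSeq.codeK -drop1 drop_drop.
apply: comp_eq.
  apply: (comp_rec (f0 := f) (f2 := fun _ _ z => tailc z) (g := g)) => //.
  apply: comp_tail; comp.
by move=> a; exact: E.
Qed.

Lemma comp_nthc c (f g : c -> nat) : carries_jump c ->
  computable f -> computable g -> computable (fun a => nthc (f a) (g a)).
Proof.
move=> hG cf cg; apply: comp_eq; first exact: (comp_head hG (comp_drop hG cf cg)).
by move=> a /=; rewrite /dropc /nthc CodeSeq.codeK nth_drop addn0.
Qed.

Lemma comp_sizec c (f : c -> nat) : carries_jump c -> computable f ->
  computable (fun a => sizec (f a)).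
Proof.
move=> hG cf; apply: (comp_let (f := fun _ s => sizec s)) => //.
pose P s n := dropc s n = 0 /\ forall m, m < n -> dropc s m <> 0.
apply: (@comp_eq (ext c) (fun p => least (P p.2))).
  by rewrite /P; comp; apply: comp_drop; comp.
have code0 l : CodeSeq.code l = 0 -> l = [::].
  by move=> h; rewrite -(CodeSeq.codeK l) h.
move=> [_ s] /=; have Ps : P s (sizec s).
  split=> [|m ms /code0 /(congr1 size)]; first by rewrite /dropc drop_oversize.
  by rewrite size_drop /=; move: ms; rewrite /sizec; lia.
have [/code0 /(congr1 size)/=] := leastP Ps.
rewrite size_drop -/(sizec s) => h1 /(_ (sizec s)) h2.
have /negP : ~ sizec s < least (P s) by move=> /h2; apply; case: Ps.
by rewrite -leqNgt => h3; apply/eqP; rewrite eqn_leq h3 -subn_eq0 h1.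
Qed.

Lemma initsegK g n i : i < n -> nthc (initseg g n) i = g i.
Proof. by move=> hi; rewrite /nthc /initseg CodeSeq.codeK nth_mkseq. Qed.

Lemma size_initseg g n : sizec (initseg g n) = n.
Proof. by rewrite /sizec /initseg CodeSeq.codeK size_mkseq. Qed.

(** * Rational numbers *)

Local Open Scope ring_scope.

(** A computable representation as (x - y) / (z + 1) rather than a computable
code, so that arithmetic on rationals is polynomial arithmetic on numbers and no
code is ever built. *)
Definition rcomputable c (r : c -> rat) :=
  exists x y z : c -> nat, [/\ computable x, computable y, computable z &
    forall a, r a = ((x a)%:R - (y a)%:R) / (z a).+1%:R].

Lemma rcomp_ratc c (f : c -> nat) : carries_jump c -> computable f ->
  rcomputable (fun a => ratc (f a)).
Proof.
move=> hG cf; exists (fun a => nthc (f a) 0), (fun a => nthc (f a) 1), (fun a => nthc (f a) 2).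
split; try (apply: comp_nthc; comp).
by move=> a; rewrite /ratc /= rmorphB /= !pmulrn.
Qed.

Lemma ratc_onto (r : rat) : exists n, ratc n = r.
Proof.
have hd : (0 < `|denq r|)%N by rewrite absz_gt0 denq_neq0.
have hdE : (`|denq r|%N.-1.+1)%:R = (denq r)%:~R :> rat.
  by rewrite prednK// pmulrn gez0_abs ?denq_ge0.
exists (CodeSeq.code [:: if numq r >= 0 then `|numq r|%N else 0%N;
   if numq r >= 0 then 0%N else `|numq r|%N; `|denq r|%N.-1]).
rewrite /ratc CodeSeq.codeK /= hdE -[RHS]divq_num_den; congr (_%:~R / _).
case: (leP 0 (numq r)) => h; first by rewrite subr0 gez0_abs.
by rewrite sub0r ltz0_abs ?opprK.
Qed.

Lemma rcomp_const c (q : rat) : rcomputable (fun _ : c => q).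
Proof.
have [n <-] := ratc_onto q; pose s := CodeSeq.decode n.
exists (fun=> nth 0%N s 0), (fun=> nth 0%N s 1), (fun=> nth 0%N s 2).
split; try exact: comp_const.
by move=> a; rewrite /ratc /= rmorphB /= !pmulrn.
Qed.

Lemma rcomp_add c (r s : c -> rat) : rcomputable r -> rcomputable s ->
  rcomputable (fun a => r a + s a).
Proof.
move=> [x [y [z [cx cy cz hr]]]] [x' [y' [z' [cx' cy' cz' hs]]]].
exists (fun a => x a * (z' a).+1 + x' a * (z a).+1)%N,
  (fun a => y a * (z' a).+1 + y' a * (z a).+1)%N, (fun a => ((z a).+1 * (z' a).+1).-1)%N.
split; comp; move=> a; rewrite hr hs.
rewrite prednK ?muln_gt0// !natrD !natrM.
have h (n : nat) : n.+1%:R != 0 :> rat by rewrite pnatr_eq0.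
move: (h (z a)) (h (z' a)); move: ((z a).+1%:R) ((z' a).+1%:R) => u v hu hv.
by field; rewrite hu hv.
Qed.

Lemma rcomp_opp c (r : c -> rat) : rcomputable r -> rcomputable (fun a => - r a).
Proof.
move=> [x [y [z [cx cy cz hr]]]]; exists y, x, z; split=> // a.
by rewrite hr -mulNr opprB.
Qed.

Lemma rcomp_pow2 c (f : c -> nat) : computable f -> rcomputable (fun a => 2 ^- f a).
Proof.
move=> cf; exists (fun=> 1%N), (fun=> 0%N), (fun a => (2 ^ f a).-1).
split; comp; move=> a.
by rewrite prednK ?expn_gt0// subr0 natrX div1r.
Qed.

Lemma dec_rlt c (r s : c -> rat) : rcomputable r -> rcomputable s ->
  dec (fun a => r a < s a).
Proof.
move=> [x [y [z [cx cy cz hr]]]] [x' [y' [z' [cx' cy' cz' hs]]]].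
apply: (@dec_iff _ (fun a => x a * (z' a).+1 + y' a * (z a).+1 <
  x' a * (z a).+1 + y a * (z' a).+1)%N); first by comp.
move=> a; rewrite hr hs ltr_pdivrMr ?ltr0Sn// mulrAC ltr_pdivlMr ?ltr0Sn//.
rewrite !mulrBl ltrBlDr addrAC ltrBrDr -!natrM -!natrD ltr_nat.
by [].
Qed.

Lemma dec_rle c (r s : c -> rat) : rcomputable r -> rcomputable s ->
  dec (fun a => r a <= s a).
Proof.
move=> cr cs; apply: dec_iff; first exact/dec_not/(dec_rlt cs cr).
by move=> a /=; rewrite leNgt; split=> /negP.
Qed.

Lemma rcomp_weak c (r : c -> rat) : rcomputable r -> rcomputable (c := ext c) (fun p => r p.1).
Proof.
move=> [x [y [z [cx cy cz hr]]]].
exists (fun p => x p.1), (fun p => y p.1), (fun p => z p.1).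
by split; [leaf|leaf|leaf|move=> p; exact: hr].
Qed.

(** * Testing for large values *)

Definition signed (V : zmodType) (s : bool) (v : V) := if s then - v else v.

(** For x representing the real v, says that v (or -v, if s) is above b: it is so
as soon as an approximation is above b by more than its error. *)
Definition exceeds_at (x : nat -> nat) (s : bool) (b : rat) :=
  exists k, b + 2 ^- k < signed s (ratc (x k)).

(* [value1] and [value2] name the application of an oracle, which unification
   would otherwise not recognize. *)
Definition value1 (U : interp (ty0 ~> ty1 ~> ty1)) (n : nat) (x : nat -> nat)
  : nat -> nat := U n x.

Definition value2 (U : interp (ty0 ~> ty0 ~> ty1 ~> ty1)) (n m : nat)
  (x : nat -> nat) : nat -> nat := U n m x.

(** Arithmetical form of: f or -f takes a value above b in the interval from p
to q.  That f(y) > b means that some e, N satisfy u_n(y) >= b + 2^-e for all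
n >= N; by compactness such a y exists as soon as, for each t, a rational point
meets the first t conditions up to 2^-t. *)
Definition exceeds1 (U : interp (ty0 ~> ty1 ~> ty1)) (s : bool) (p q b : rat) :=
  exists e N : nat, forall t : nat, exists z : nat, (p <= ratc z /\ ratc z <= q) /\
    forall n : nat, (n < t)%N -> (N <= n)%N ->
      exceeds_at (value1 U n (fun=> z)) s (b + 2 ^- e - 2 ^- t).

(** As above for a double limit, with h(n) a bound from which on the inner
sequence at n stays large.  No real is quantified, and stage t looks at h below
t only: w is the code of its initial segment of length t, which is the form of
condition that the Suslin functional accepts. *)
Definition stage2 (U : interp (ty0 ~> ty0 ~> ty1 ~> ty1)) (s : bool)
    (p q b : rat) (N w : nat) :=
  exists z : nat, (p <= ratc z /\ ratc z <= q) /\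
    forall n m : nat, (n < sizec w)%N -> (m < sizec w)%N -> (N <= n)%N ->
      (nthc w n <= m)%N ->
      exceeds_at (value2 U n m (fun=> z)) s (b - 2 ^- sizec w).

Definition exceeds2 (U : interp (ty0 ~> ty0 ~> ty1 ~> ty1)) (s : bool) (p q b : rat) :=
  exists e N : nat, exists h : nat -> nat, forall t : nat,
    stage2 U s p q (b + 2 ^- e) N (initseg h t).

Ltac rleaf := first [ leaf | refine (rcomp_weak (r := _) _); rleaf ].

Lemma rcomp_signed c s (r : c -> rat) : rcomputable r -> rcomputable (fun a => signed s (r a)).
Proof. by case: s => // /rcomp_opp. Qed.

Lemma comp_value1 c U (n k : c -> nat) (x : c -> nat -> nat) :
  carries U -> computable n -> computable (c := ext c) (fun p => x p.1 p.2) ->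
  computable k -> computable (fun a => value1 (U a) (n a) (x a) (k a)).
Proof. exact: comp_seq1. Qed.

Lemma comp_value2 c U (n m k : c -> nat) (x : c -> nat -> nat) :
  carries U -> computable n -> computable m ->
  computable (c := ext c) (fun p => x p.1 p.2) ->
  computable k -> computable (fun a => value2 (U a) (n a) (m a) (x a) (k a)).
Proof. exact: comp_seq2. Qed.

Ltac comp_step ::= first
  [ rleaf
  | apply: dec_and | apply: dec_or | apply: dec_imp | apply: dec_not
  | apply: dec_ex | apply: dec_all | apply: dec_leq | apply: dec_eqn
  | apply: dec_rlt | apply: dec_rle
  | apply: comp_succ | apply: comp_pred | apply: comp_add | apply: comp_mul
  | apply: comp_sub | apply: comp_exp2 | apply: comp_least
  | apply: comp_nthc | apply: comp_sizec
  | apply: rcomp_signed | apply: rcomp_const | apply: rcomp_add | apply: rcomp_opp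
  | apply: rcomp_pow2 | apply: rcomp_ratc
  | apply: comp_value1 | apply: comp_value2 ].

Lemma dec_exceeds_at c (x : c -> nat -> nat) s (b : c -> rat) : carries_jump c ->
  computable (c := ext c) (fun p => x p.1 p.2) -> rcomputable b ->
  dec (fun a => exceeds_at (x a) s (b a)).
Proof. by move=> hG cx cb; rewrite /exceeds_at; comp. Qed.

(* Tried first, since the other rules would see through the definition. *)
Ltac comp ::= repeat first [apply: dec_exceeds_at | comp_step].

Lemma dec_exceeds1 c (U : c -> interp (ty0 ~> ty1 ~> ty1)) s (p q b : c -> rat) :
  carries_jump c -> carries U -> rcomputable p -> rcomputable q -> rcomputable b ->
  dec (fun a => exceeds1 (U a) s (p a) (q a) (b a)).
Proof. by move=> hG hU cp cq cb; rewrite /exceeds1; comp. Qed.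

Lemma dec_exceeds2 c (U : c -> interp (ty0 ~> ty0 ~> ty1 ~> ty1)) s (p q b : c -> rat) :
  carries (s := ty2) (fun _ : c => Suslin2) ->
  carries U -> rcomputable p -> rcomputable q -> rcomputable b ->
  dec (fun a => exceeds2 (U a) s (p a) (q a) (b a)).
Proof.
move=> hS hU cp cq cb; rewrite /exceeds2.
have hG : carries_jump c by exists Suslin2 => //; right.
apply: dec_ex => //; apply: dec_ex; first leaf.
apply: (dec_Suslin (c := ext (ext c)) (P := fun a w =>
    stage2 (U a.1.1) s (p a.1.1) (q a.1.1) (b a.1.1 + 2 ^- a.1.2) a.2 w)).
  exact: (carries_weak (carries_weak hS)).
by rewrite /stage2; comp.
Qed.

Local Open Scope classical_set_scope.
Local Open Scope ring_scope.

(** * Approximation of reals *)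

(* [lra] with powers of two as unknowns *)
Ltac plra :=
  repeat match goal with
    H : is_true ?P |- _ =>
      match P with context [GRing.inv (GRing.exp _ _)] => revert H end
  | H : ?a = _ |- _ =>
      match a with context [GRing.inv (GRing.exp _ _)] => revert H end end;
  repeat match goal with
    |- context [@GRing.inv ?A (@GRing.exp ?B ?x ?n)] =>
      let w := fresh in move: (@GRing.inv A (@GRing.exp B x n)) => w end;
  intros; lra.

Section Analysis.
Variable R : realType.
Implicit Types (f : R -> R) (y : R) (p q b : rat).

Lemma pow2_gt0 n : 0 < 2 ^- n :> R.
Proof. by rewrite invr_gt0 exprn_gt0. Qed.

Lemma pow2_lt (g : R) : 0 < g -> exists k : nat, 2 ^- k < g.
Proof.
move=> g0; exists (Num.bound g^-1); set k := Num.bound _.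
rewrite invf_plt ?posrE ?exprn_gt0//.
apply: lt_le_trans (archi_boundP _) _; first by rewrite invr_ge0 ltW.
by rewrite -/k -natrX ler_nat ltnW// ltn_expl.
Qed.

Lemma pow2_le (m n : nat) : (m <= n)%N -> 2 ^- n <= 2 ^- m :> R.
Proof.
by move=> mn; rewrite lef_pV2 ?posrE ?exprn_gt0// ler_weXn2l// ler1n.
Qed.

Lemma pow2S n : 2 ^- n = 2 ^- n.+1 + 2 ^- n.+1 :> R.
Proof.
have h : 2 ^+ n != 0 :> R by rewrite expf_neq0// pnatr_eq0.
by rewrite exprS; field.
Qed.

Lemma ratr_pow2 n : ratr (2 ^- n) = 2 ^- n :> R.
Proof. by rewrite fmorphV rmorphXn /= ratr_nat. Qed.

Lemma represents_dist x (v : R) : represents x v ->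
  forall n, `|ratr (ratc (x n)) - v| <= 2 ^- n.
Proof.
move=> [cx lx] n; rewrite leNgt; apply/negP => h.
have /cvgrPdist_lt/(_ (`|ratr (ratc (x n)) - v| - 2 ^- n)) := lx.
rewrite subr_gt0 => /(_ h)[M _ /(_ (n + M)%N)] /=; rewrite leq_addl => /(_ isT).
have := cx n M; rewrite -(ltr_rat R) ratr_pow2 ratr_norm rmorphB /=.
have := ler_distD (ratr (ratc (x (n + M)%N))) (ratr (ratc (x n))) v.
rewrite (distrC v) => h1 h2 h3.
move: h h1 h2 h3; plra.
Qed.

Lemma represents_const z : represents (fun=> z) (ratr (ratc z) : R).
Proof.
split; last exact: cvg_cst.
by move=> n i; rewrite subrr normr0 invr_gt0 exprn_gt0.
Qed.

Lemma represents_of_dist h (v : R) :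
  (forall n, `|ratr (ratc (h n)) - v| < 2 ^- n.+1) -> represents h v.
Proof.
move=> hv; split=> [n i|].
  rewrite -(ltr_rat R) ratr_pow2 ratr_norm rmorphB /=.
  have := ler_distD v (ratr (ratc (h n))) (ratr (ratc (h (n + i)%N))).
  have := hv n; have := hv (n + i)%N; rewrite (distrC (ratr _) v).
  have : 2 ^- (n + i).+1 <= 2 ^- n.+1 :> R by apply: pow2_le; lia.
  by rewrite (pow2S n); plra.
apply/cvgrPdist_lt => e e0; have [k hk] := pow2_lt e0.
exists k => // n /= kn; rewrite distrC; apply: lt_trans (hv n) _.
by apply: le_lt_trans _ hk; apply: pow2_le; apply: leqW.
Qed.

Lemma ratr_signed s b : ratr (signed s b) = signed s (ratr b) :> R.
Proof. by case: s => //=; rewrite rmorphN. Qed.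

Lemma signed_dist s (u v : R) : `|signed s u - signed s v| = `|u - v|.
Proof. by case: s => //=; rewrite -opprD normrN. Qed.

Lemma exceeds_atP x (v : R) s b : represents x v ->
  exceeds_at x s b <-> ratr b < signed s v.
Proof.
move=> /represents_dist xv.
have {}xv k : `|ratr (signed s (ratc (x k))) - signed s v| <= 2 ^- k.
  by rewrite ratr_signed signed_dist.
split=> [[k]|h].
  rewrite -(ltr_rat R) rmorphD /= ratr_pow2; have := xv k.
  by rewrite ler_norml => /andP[_]; plra.
have [k hk] : exists k : nat, 2 ^- k < (signed s v - ratr b) / 2.
  by apply: pow2_lt; plra.
exists k; rewrite -(ltr_rat R) rmorphD /= ratr_pow2; have := xv k.
by rewrite ler_norml => /andP[+ _]; plra.
Qed.

(** * Compactness *)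

Definition eps_continuous f := forall y, I01 y -> forall e : R, 0 < e ->
  exists2 d : R, 0 < d & forall z, I01 z -> `|y - z| < d -> `|f y - f z| < e.

Lemma within_cvgP f y : f z @[z --> within (@I01 R) (nbhs y)] --> f y <->
  forall e : R, 0 < e -> exists2 d : R, 0 < d &
    forall z, I01 z -> `|y - z| < d -> `|f y - f z| < e.
Proof.
split=> [/cvgrPdist_lt h e /h|h].
  by move=> /nbhs_ballP[d /= d0 hd]; exists d => // z Iz yz; apply: hd.
apply/cvgrPdist_lt => e /h[d d0 hd]; apply/nbhs_ballP; exists d => //= z yz Iz.
exact: hd.
Qed.

Lemma within_continuousP f : {within @I01 R, continuous f} -> eps_continuous f.
Proof.
move=> cf y Iy; apply/within_cvgP.
by have := cf y; rewrite /continuous_at nbhs_subspace_in.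
Qed.

Lemma eps_continuous_signed s f : eps_continuous f -> eps_continuous (fun y => signed s (f y)).
Proof.
move=> cf y Iy e /(cf y Iy)[d d0 hd]; exists d => // z Iz yz.
by rewrite signed_dist; apply: hd.
Qed.

Definition between p q : set R := [set y | ratr p <= y <= ratr q].

Lemma between_I01 p q y : 0 <= p -> q <= 1 -> between p q y -> I01 y.
Proof.
move=> p0 q1 /andP[py yq]; rewrite /I01 /= in_itv /=; apply/andP; split.
  by apply: le_trans py; rewrite ler0q.
by apply: le_trans yq _; rewrite -(ler_rat R) rmorph1 in q1.
Qed.

Lemma between_rat p q z : between p q (ratr z) <-> p <= z /\ z <= q.
Proof. by rewrite /between /= !ler_rat; split=> /andP. Qed.

(** Holds for p = q too: the right end point, being rational, is the witness when
y is that point. *)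
Lemma rat_near p q y d : between p q y -> 0 < d ->
  exists z, between p q (ratr z) /\ `|y - ratr z| < d.
Proof.
move=> /andP[py yq] d0; have [yq'|qy] := ltP y (ratr q); last first.
  exists q; have -> : y = ratr q by apply/le_anti; rewrite yq qy.
  by rewrite subrr normr0; split=> //; rewrite /between /= lexx (le_trans py yq).
have [] : exists z, ratr z \in `]y, (Num.min (ratr q) (y + d))[.
  by apply: rat_in_itvoo; rewrite lt_min yq' ltrDl.
move=> z; rewrite in_itv /= lt_min => /and3P[yz zq zd]; exists z; split.
  by rewrite /between /= (ltW zq) (le_trans py (ltW yz)).
by rewrite distrC gtr0_norm; plra.
Qed.

Lemma min_pos (D : nat -> R) K : (forall n, 0 < D n) ->
  exists2 d, 0 < d & forall n, (n < K)%N -> d <= D n.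
Proof.
move=> D0; elim: K => [|K [d d0 hd]]; first by exists 1.
exists (Num.min d (D K)); first by rewrite lt_min d0 D0.
move=> n; rewrite ltnS leq_eqVlt => /orP[/eqP ->|/hd]; first by rewrite ge_min lexx orbT.
by rewrite ge_min => ->.
Qed.

(** The conditions on y are closed.  From left to right, finitely many of them
persist, up to 2^-t, near y, hence at a rational point.  From right to left, any
cluster point of the rational points found for the various t meets them all. *)
Lemma compactness (v : nat -> nat -> R -> R) (Q : nat -> nat -> Prop) p q (d : R) :
  0 <= p -> q <= 1 -> (forall n m, eps_continuous (v n m)) ->
  (exists2 y, between p q y & forall n m, Q n m -> d <= v n m y) <->
  (forall t : nat, exists2 z, between p q (ratr z) & forall n m, (n < t)%N -> (m < t)%N ->
    Q n m -> d - 2 ^- t < v n m (ratr z)).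
Proof.
move=> p0 q1 cv; split=> [[y ypq hy] t|H].
  have Iy := between_I01 p0 q1 ypq.
  have hD n m : exists D, 0 < D /\
      forall z, I01 z -> `|y - z| < D -> `|v n m y - v n m z| < 2 ^- t.
    by have [D] := cv n m y Iy _ (pow2_gt0 t); exists D.
  have /choice[D DP] : forall n, exists D, 0 < D /\ forall m, (m < t)%N ->
      forall z, I01 z -> `|y - z| < D -> `|v n m y - v n m z| < 2 ^- t.
    move=> n; have /choice[D DP] := hD n.
    have [e e0 he] := @min_pos D t (fun m => (DP m).1); exists e; split=> // m mt z Iz yz.
    by apply: (DP m).2 => //; apply: lt_le_trans yz (he _ mt).
  have [e e0 he] := @min_pos D t (fun m => (DP m).1).
  have [z [zpq yz]] := rat_near ypq e0; exists z => // n m nt mt Qnm.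
  have := (DP n).2 m mt (ratr z) (between_I01 p0 q1 zpq) (lt_le_trans yz (he _ nt)).
  by rewrite ltr_norml => /andP[_]; have := hy n m Qnm; plra.
have /choice[z zP] : forall t, exists z, between p q (ratr z) /\
    forall n m, (n < t)%N -> (m < t)%N -> Q n m -> d - 2 ^- t < v n m (ratr z).
  by move=> t; have [z] := H t; exists z.
have /(_ (ratr (z t) @[t --> \oo])) := @segment_compact R (ratr p) (ratr q).
case=> [|y [ypq ycl]].
  by exists 0%N => // t _; rewrite /= in_itv; exact: (zP t).1.
have {}ypq : between p q y by move: ypq; rewrite /= in_itv.
exists y => // n m Qnm; rewrite leNgt; apply/negP => lt_d.
have Iy := between_I01 p0 q1 ypq.
have g0 : 0 < (d - v n m y) / 2 by plra.
have [e e0 he] := cv n m y Iy _ g0; have [k hk] := pow2_lt g0.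
have [_ [[t tK <-] /= yz]] : [set ratr (z t) | t in [set t | (n + m + k < t)%N]]
    `&` ball y e !=set0.
  apply: ycl; last exact: nbhsx_ballx.
  by exists (n + m + k).+1 => // t /= ht; exists t.
have := (zP t).2 n m; have := he _ (between_I01 p0 q1 (zP t).1) yz.
have : 2 ^- t <= 2 ^- k :> R by apply: pow2_le; move: tK => /=; lia.
rewrite ltr_norml => h1 /andP[h2 h3] /(_ _ _ Qnm) h4.
have {}h4 : d - 2 ^- t < v n m (ratr (z t)) by apply: h4; move: tK => /=; lia.
move: hk h1 h2 h4; move: (v n m y) (v n m (ratr (z t))) => /= u w.
clear; plra.
Qed.

End Analysis.

(** * Large values of Baire functions *)

Section Exceeding.
Variable R : realType.
Implicit Types (f : R -> R) (y : R) (p q b : rat).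

Lemma cvg_eventually_ge (u : nat -> R) (l a : R) : u n @[n --> \oo] --> l -> a < l ->
  exists N : nat, forall n, (N <= n)%N -> a <= u n.
Proof.
move=> /cvgrPdist_lt ul al.
have [N _ hN] := ul (l - a) (ltac:(by rewrite subr_gt0)).
exists N => n /hN /=; rewrite ltr_norml => /andP[_]; lra.
Qed.

Lemma eventually_ge_limit (u : nat -> R) (l a : R) (N : nat) : u n @[n --> \oo] --> l ->
  (forall n, (N <= n)%N -> a <= u n) -> a <= l.
Proof.
move=> /cvgrPdist_lt ul aN; rewrite leNgt; apply/negP => la.
have [M _ hM] := ul (a - l) (ltac:(by rewrite subr_gt0)).
have := hM (N + M)%N (leq_addl _ _); have := aN (N + M)%N (leq_addr _ _).
by rewrite /= ltr_norml => h1 /andP[h2 _]; move: h1 h2; lra.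
Qed.

Lemma signed_cvg s (u : nat -> R) (l : R) : u n @[n --> \oo] --> l ->
  signed s (u n) @[n --> \oo] --> signed s l.
Proof. by case: s => //=; apply: cvgN. Qed.

Lemma lt_pow2 (a b : R) : a < b -> exists e : nat, a + 2 ^- e < b.
Proof.
by rewrite -subr_gt0 => /pow2_lt[e he]; exists e; rewrite addrC -ltrBrDr.
Qed.

Lemma exceeds_limit1 (u : nat -> R) (l a : R) : u n @[n --> \oo] --> l ->
  a < l <-> exists e N : nat, forall n, (N <= n)%N -> a + 2 ^- e <= u n.
Proof.
move=> ul; split=> [/lt_pow2[e /(cvg_eventually_ge ul) h]|[e [N h]]]; first by exists e.
have := eventually_ge_limit ul h; have := pow2_gt0 R e; lra.
Qed.

(** The bound h collects one witness per n of the inner limits.  The margin 2^-e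
can be the same for all n because the outer limit leaves room for it. *)
Lemma exceeds_limit2 (u : nat -> nat -> R) (l : nat -> R) (l' a : R) :
  (forall n, u n m @[m --> \oo] --> l n) -> l n @[n --> \oo] --> l' ->
  a < l' <-> exists e N : nat, exists h : nat -> nat,
    forall n m, (N <= n)%N -> (h n <= m)%N -> a + 2 ^- e <= u n m.
Proof.
move=> ul ll; split=> [|[e [N [h H]]]]; last first.
  apply/(exceeds_limit1 _ ll); exists e, N => n Nn.
  by apply: eventually_ge_limit (ul n) (H n ^~ Nn).
move=> /lt_pow2[e /lt_pow2[e' /(cvg_eventually_ge ll)[N hN]]].
have /choice[h hP] : forall n, exists h, (N <= n)%N ->
    forall m, (h <= m)%N -> a + 2 ^- e <= u n m.
  move=> n; have [Nn|_] := leqP N n; last by exists 0%N.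
  have [|h H] := @cvg_eventually_ge _ _ (a + 2 ^- e) (ul n); last by exists h.
  by have := hN n Nn; have := pow2_gt0 R e'; lra.
by exists e, N, h => n m Nn; apply: hP.
Qed.

Lemma exceeds1P U f s p q b : baire1_rep U f -> 0 <= p -> q <= 1 ->
  exceeds1 U s p q b <-> exists2 y, between p q y & ratr b < signed s (f y).
Proof.
move=> [u [[cu uf] rU]] p0 q1.
pose v (n m : nat) y := signed s (u n y).
have cv n m : eps_continuous (v n m).
  exact/eps_continuous_signed/within_continuousP.
have at_rat n z b' : between p q (ratr (ratc z) : R) ->
    exceeds_at (value1 U n (fun=> z)) s b' <-> ratr b' < v n 0%N (ratr (ratc z)).
  move=> zpq; apply: exceeds_atP; apply: rU; last exact: represents_const.
  exact: between_I01 zpq.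
transitivity (exists e N : nat, exists2 y, between p q y &
    forall n m : nat, (N <= n)%N -> ratr b + 2 ^- e <= v n m y).
  split=> -[e [N H]]; exists e, N.
    apply/(compactness (fun n _ => (N <= n)%N) _ p0 q1 cv) => t.
    have [z [/between_rat zpq hz]] := H t; exists (ratc z); first exact/zpq.
    move=> n m nt _ Nn; have /at_rat := hz n nt Nn.
    by rewrite rmorphB rmorphD /= !ratr_pow2; apply; apply/zpq.
  move=> t.
  have [z zpq hz] := proj1 (compactness (fun n _ => (N <= n)%N)
    (ratr b + 2 ^- e) p0 q1 cv) H t.
  have [i zi] := ratc_onto z; subst z; exists i; split; first exact/between_rat/zpq.
  move=> n nt Nn; apply/at_rat => //.
  by rewrite rmorphB rmorphD /= !ratr_pow2; apply: (hz n n).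
split=> [[e [N [y ypq H]]]|[y ypq H]].
  exists y => //; apply: (proj2 (exceeds_limit1 _ (signed_cvg (s := s) (uf y (between_I01 p0 q1 ypq))))).
  by exists e, N => n Nn; apply: (H n 0%N).
have [e [N hN]] := proj1 (exceeds_limit1 (ratr b)
  (signed_cvg (s := s) (uf y (between_I01 p0 q1 ypq)))) H.
by exists e, N, y => // n m; apply: hN.
Qed.

Lemma exceeds2P U f s p q b : baire2_rep U f -> 0 <= p -> q <= 1 ->
  exceeds2 U s p q b <-> exists2 y, between p q y & ratr b < signed s (f y).
Proof.
move=> [u [[cu uf] rU]] p0 q1.
pose v (n m : nat) y := signed s (u n m y).
have cv n m : eps_continuous (v n m).
  exact/eps_continuous_signed/within_continuousP.
have at_rat n m z b' : between p q (ratr (ratc z) : R) ->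
    exceeds_at (value2 U n m (fun=> z)) s b' <-> ratr b' < v n m (ratr (ratc z)).
  move=> zpq; apply: exceeds_atP; apply: rU; last exact: represents_const.
  exact: between_I01 zpq.
transitivity (exists e N : nat, exists h : nat -> nat, exists2 y, between p q y &
    forall n m : nat, (N <= n)%N /\ (h n <= m)%N -> ratr b + 2 ^- e <= v n m y).
  split=> -[e [N [h H]]]; exists e, N, h.
    apply/(compactness (fun n m => (N <= n)%N /\ (h n <= m)%N) _ p0 q1 cv) => t.
    have [z [/between_rat zpq]] := H t; rewrite size_initseg => hz.
    exists (ratc z); first exact/zpq.
    move=> n m nt mt [Nn hm]; have := hz n m nt mt Nn; rewrite initsegK// => /(_ hm)/at_rat.
    by rewrite rmorphB rmorphD /= !ratr_pow2; apply; apply/zpq.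
  move=> t.
  have [z zpq hz] := proj1 (compactness (fun n m => (N <= n)%N /\ (h n <= m)%N)
    (ratr b + 2 ^- e) p0 q1 cv) H t.
  have [i zi] := ratc_onto z; subst z; exists i; split; first exact/between_rat/zpq.
  rewrite size_initseg => n m nt mt Nn; rewrite initsegK// => hm; apply/at_rat => //.
  by rewrite rmorphB rmorphD /= !ratr_pow2; apply: (hz n m).
split=> [[e [N [h [y ypq H]]]]|[y ypq H]].
  have [l [ul lf]] := uf y (between_I01 p0 q1 ypq).
  exists y => //; apply: (proj2 (exceeds_limit2 _ (fun n => signed_cvg (s := s) (ul n))
    (signed_cvg (s := s) lf))).
  by exists e, N, h => n m Nn hm; apply: (H n m).
have [l [ul lf]] := uf y (between_I01 p0 q1 ypq).
have [e [N [h hN]]] := proj1 (exceeds_limit2 (ratr b)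
  (fun n => signed_cvg (s := s) (ul n)) (signed_cvg (s := s) lf)) H.
by exists e, N, h, y => // n m [? ?]; apply: hN.
Qed.

End Exceeding.

(** * Continuity at a point through rational intervals *)

Section Oscillation.
Variable R : realType.
Implicit Types (f : R -> R) (r y : R).

(** A rational interval [a, b] contains all points of [0, 1] at distance less
than 2^-N of r, and f is on it within 2^-(k+2) of a rational c.  Neither f(r)
nor a representation of r occurs here, which makes the resulting modulus a
function of the real r. *)
Definition oscillation f r (k N : nat) := exists a b c : nat,
  [/\ 0 <= ratc a, ratc a <= ratc b & ratc b <= 1] /\
  [/\ ratc a <= 0 \/ ratr (ratc a) + 2 ^- N < r,
      1 <= ratc b \/ r < ratr (ratc b) - 2 ^- N &
      forall y, between (ratc a) (ratc b) y -> `|f y - ratr (ratc c)| <= 2 ^- k.+2].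

Lemma oscillation_lt f r k N y : oscillation f r k N -> I01 r -> I01 y ->
  `|r - y| < 2 ^- N -> `|f r - f y| < 2 ^- k.
Proof.
move=> [a [b [c [[a0 ab b1] [ha hb fc]]]]].
rewrite /I01 /= !in_itv /= => /andP[r0 r1] /andP[y0 y1].
rewrite ltr_norml => /andP[ry1 ry2].
have inab z : 0 <= z -> z <= 1 -> `|r - z| < 2 ^- N -> between (ratc a) (ratc b) z.
  move=> z0 z1; rewrite ltr_norml => /andP[rz1 rz2]; apply/andP; split.
    case: ha => [a0'|]; last by move=> ?; plra.
    by apply: le_trans z0; rewrite -(ler_rat R) rmorph0 in a0'.
  case: hb => [b1'|]; last by move=> ?; plra.
  by apply: le_trans z1 _; rewrite -(ler_rat R) rmorph1 in b1'.
have := fc _ (inab _ r0 r1 _); rewrite subrr normr0 => /(_ (pow2_gt0 _ _)) h1.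
have h2 : `|f y - ratr (ratc c)| <= 2 ^- k.+2.
  by apply: fc; apply: inab => //; rewrite ltr_norml ry1.
have := ler_distD (ratr (ratc c)) (f r) (f y); rewrite (distrC (ratr _) (f y)).
have := pow2S R k.+1; have := pow2S R k; have := pow2_gt0 R k.+1.
by move: h1 h2; plra.
Qed.

Lemma cont_oscillation f r : I01 r ->
  cont_points f r <-> forall k, exists N, oscillation f r k N.
Proof.
move=> Ir; split=> [[_ /within_cvgP cf] k|H]; last first.
  split=> //; apply/within_cvgP => e /pow2_lt[k ke]; have [N hN] := H k.
  exists (2 ^- N); first exact: pow2_gt0.
  by move=> z Iz rz; apply: lt_trans (oscillation_lt hN Ir Iz rz) ke.
have [d d0 hd] := cf (2 ^- k.+3) (pow2_gt0 _ _).
have [N hN] := pow2_lt d0.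
have r01 : 0 <= r <= 1 by move: Ir; rewrite /I01 /= in_itv.
(* the end points are taken beyond the ball of radius 2^-N, yet closer to r than
   the d given by continuity, unless 0 or 1 comes first *)
have [a [a0 ar ha had]] : exists a, [/\ 0 <= ratc a, ratr (ratc a) <= r,
    ratc a <= 0 \/ ratr (ratc a) + 2 ^- N < r & r - d < ratr (ratc a)].
  have [rd|rd] := ltP (r - d) 0.
    have [a aE] := ratc_onto 0; exists a; rewrite aE rmorph0; split=> //; last by left.
    by case/andP: r01.
  have [|z] := @rat_in_itvoo R (r - d) (r - 2 ^- N); first by rewrite ltrD2l ltrN2.
  rewrite in_itv /= => /andP[z1 z2]; have [a aE] := ratc_onto z; exists a; rewrite aE; split=> //.
  - by rewrite -(ler0q R); apply: le_trans rd (ltW z1).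
  - by have := pow2_gt0 R N; plra.
  - by right; plra.
have [b [b1 rb hb hbd]] : exists b, [/\ ratc b <= 1, r <= ratr (ratc b),
    1 <= ratc b \/ r < ratr (ratc b) - 2 ^- N & ratr (ratc b) < r + d].
  have [rd|rd] := ltP 1 (r + d).
    have [b bE] := ratc_onto 1; exists b; rewrite bE rmorph1; split=> //; last by left.
    by case/andP: r01.
  have [|z] := @rat_in_itvoo R (r + 2 ^- N) (r + d); first by rewrite ltrD2l.
  rewrite in_itv /= => /andP[z1 z2]; have [b bE] := ratc_onto z; exists b; rewrite bE; split=> //.
  - by rewrite -(ler_rat R) rmorph1; apply: le_trans (ltW z2) rd.
  - by have := pow2_gt0 R N; plra.
  - by right; plra.
have [|z] := @rat_in_itvoo R (f r - 2 ^- k.+3) (f r).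
  by rewrite ltrBlDr ltrDl pow2_gt0.
rewrite in_itv /= => /andP[z1 z2]; have [c cE] := ratc_onto z.
exists N, a, b, c; split; first by split=> //; rewrite -(ler_rat R) (le_trans ar).
split=> // y yab; rewrite cE.
have Iy : I01 y by apply: between_I01 yab.
have {hd} := hd y Iy.
have ry : `|r - y| < d.
  by case/andP: yab => ay yb; rewrite ltr_norml; apply/andP; split; lra.
move=> /(_ ry); rewrite !ltr_norml ler_norml => /andP[h1 h2].
have := pow2S R k.+2; have := pow2_gt0 R k.+3.
by move=> h3 h4; apply/andP; split; plra.
Qed.

End Oscillation.

(** * Supremum, continuity points and modulus *)

Section FromValueQueries.
Variables (R : realType) (G : interp ty2) (T : ty).
Variable rep : interp T -> (R -> R) -> Prop.
(* [exceeds U s p q b] decides, from the representation U of f, whether f (or -f,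
   if s) takes a value above b between p and q: this is all that the three tasks
   need to know of f *)
Variable exceeds : interp T -> bool -> rat -> rat -> rat -> Prop.

Hypothesis G_jumps : jumps G.
Hypothesis dec_exceeds : forall (c : ctx) (U : c -> interp T) s (p q b : c -> rat),
  carries (s := ty2) (fun _ : c => G) ->
  carries U -> rcomputable p -> rcomputable q -> rcomputable b ->
  dec (fun a => exceeds (U a) s (p a) (q a) (b a)).
Hypothesis exceedsP : forall U f s p q b, rep U f -> 0 <= p -> q <= 1 ->
  exceeds U s p q b <-> exists2 y : R, between p q y & ratr b < signed s (f y).

Lemma not_exceedsP U f s p q b : rep U f -> 0 <= p -> q <= 1 ->
  ~ exceeds U s p q b <-> forall y : R, between p q y -> signed s (f y) <= ratr b.
Proof.
move=> Uf p0 q1; rewrite (exceedsP _ _ Uf p0 q1); split=> [h y ypq|h [y ypq]].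
  by rewrite leNgt; apply/negP => ?; apply: h; exists y.
by rewrite ltNge h.
Qed.

(** The rational coded by i is at distance less than 2^-(k+1) of the supremum.
The margin above is the smaller one because a negative answer bounds the
supremum only weakly. *)
Definition sup_test (U : interp T) (p q k i : nat) :=
  exceeds U false (ratc p) (ratc q) (ratc i - 2 ^- k.+1) /\
  ~ exceeds U false (ratc p) (ratc q) (ratc i + 2 ^- k.+2).

Definition inputs := (interp (ty1 ~> ty1) * interp T)%type.

Definition sup_ctx : ctx := @Ctx (inputs * nat * nat * nat)
  (fun a => [:: Obj G; Obj a.1.1.1.1; Obj a.1.1.1.2; num a.1.1.2; num a.1.2; num a.2])
  6 (fun=> erefl).

Lemma sup_computable_of_exceeds : sup_computable G rep (@I01_valued R).
Proof.
have hG : carries (c := sup_ctx) (s := ty2) (fun=> G) by exists 0%N.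
have hJ : carries_jump sup_ctx by exists G.
have hU : carries (c := sup_ctx) (s := T) (fun a => a.1.1.1.2) by exists 2%N.
have cp : computable (c := sup_ctx) (fun a => a.1.1.2) by apply: comp_num; exists 3%N.
have cq : computable (c := sup_ctx) (fun a => a.1.2) by apply: comp_num; exists 4%N.
have ck : computable (c := sup_ctx) (fun a => a.2) by apply: comp_num; exists 5%N.
have [e he] : computable (c := sup_ctx)
    (fun a => least (sup_test a.1.1.1.2 a.1.1.2 a.1.2 a.2)).
  have hG1 := carries_weak hG; have hU1 := carries_weak hU.
  have cp1 := comp_weak cp; have cq1 := comp_weak cq.
  apply: comp_least => //; rewrite /sup_test.
  apply: dec_and; [|apply: dec_not];
    apply: (dec_exceeds (c := ext sup_ctx) (U := fun p => p.1.1.1.1.2)); comp.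
exists e => f F U If Ff Uf p q p0 pq q1.
exists (fun k => least (sup_test U p q k)); split.
  by move=> k; exact: (he (F, U, p, q, k)).
apply: represents_of_dist => k.
set s := sup_on f _ _; pose S := f @` `[ratr (ratc p), ratr (ratc q)].
have SE y : between (ratc p) (ratc q) y -> S (f y).
  by move=> ypq; exists y => //; rewrite /= in_itv.
have S0 : S !=set0.
  by exists (f (ratr (ratc p))); apply: SE; apply/between_rat.
have ubS : ubound S 1.
  move=> _ [y ypq <-]; have /If : I01 y.
    by apply: between_I01 p0 q1 _; move: ypq; rewrite /= in_itv.
  by rewrite /I01 /= in_itv => /andP[].
have below b : exceeds U false (ratc p) (ratc q) b <-> ratr b < s.
  rewrite (exceedsP _ _ Uf p0 q1); split=> [[y ypq by_]|].
    by apply: lt_le_trans by_ _; apply: ub_le_sup; [exists 1|apply: SE].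
  by move=> /(sup_gt S0)[_ [y ypq <-] by_]; exists y.
have [i hi] : exists i, sup_test U p q k i.
  have [|z] := @rat_in_itvoo R (s - 2 ^- k.+2) s; first by rewrite ltrBlDr ltrDl pow2_gt0.
  rewrite in_itv /= => /andP[z1 z2]; have [i iE] := ratc_onto z; exists i.
  rewrite /sup_test !below iE rmorphB rmorphD /= !ratr_pow2.
  split; first by have := pow2_gt0 R k.+1; plra.
  by apply/negP; rewrite -leNgt; plra.
have [] := leastP hi; rewrite !below rmorphB rmorphD /= !ratr_pow2 => h1 /negP.
rewrite -leNgt => h2.
have := pow2S R k.+1; have := pow2_gt0 R k.+2; move: h1 h2.
by move=> *; rewrite ltr_norml; apply/andP; split; plra.
Qed.

(** The relation [oscillation], with f seen through its value queries and r
through a representation. *)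
Definition osc_test (U : interp T) (x : nat -> nat) (k N : nat) :=
  exists a b c : nat,
  (0 <= ratc a /\ ratc a <= ratc b /\ ratc b <= 1) /\
  (ratc a <= 0 \/ exceeds_at x false (ratc a + 2 ^- N)) /\
  (1 <= ratc b \/ exceeds_at x true (- (ratc b - 2 ^- N))) /\
  ~ exceeds U false (ratc a) (ratc b) (ratc c + 2 ^- k.+2) /\
  ~ exceeds U true (ratc a) (ratc b) (- (ratc c - 2 ^- k.+2)).

Lemma osc_testP U f x r k N : rep U f -> represents x r ->
  osc_test U x k N <-> oscillation f r k N.
Proof.
move=> Uf xr; split=> -[a [b [c]]]; last first.
  move=> [[a0 ab b1] [ha hb fc]]; exists a, b, c; do !split=> //.
  - case: ha => ha; [by left|right].
    by apply/(exceeds_atP false _ xr); rewrite rmorphD /= ratr_pow2.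
  - case: hb => hb; [by left|right].
    by apply/(exceeds_atP true _ xr); rewrite rmorphN rmorphB /= ratr_pow2 ltrN2.
  - apply/(not_exceedsP _ _ Uf a0 b1) => y /fc.
    by rewrite rmorphD /= ratr_pow2 ler_norml => /andP[_]; plra.
  - apply/(not_exceedsP _ _ Uf a0 b1) => y /fc.
    by rewrite rmorphN rmorphB /= ratr_pow2 lerN2 ler_norml => /andP[+ _]; plra.
move=> [[a0 [ab b1]] [ha [hb [up low]]]]; exists a, b, c; split=> //; split.
- case: ha => [|/(exceeds_atP false _ xr)]; first by left.
  by rewrite rmorphD /= ratr_pow2; right.
- case: hb => [|/(exceeds_atP true _ xr)]; first by left.
  by rewrite rmorphN rmorphB /= ratr_pow2 ltrN2; right.
- move=> y yab; have := proj1 (not_exceedsP _ _ Uf a0 b1) up y yab.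
  have := proj1 (not_exceedsP _ _ Uf a0 b1) low y yab.
  rewrite /= rmorphN rmorphB rmorphD /= !ratr_pow2 lerN2 ler_norml => h1 h2.
  by apply/andP; split; plra.
Qed.

Lemma dec_osc_test (c : ctx) (U : c -> interp T) (x : c -> nat -> nat) (k N : c -> nat) :
  carries (s := ty2) (fun _ : c => G) -> carries U ->
  computable (c := ext c) (fun p => x p.1 p.2) -> computable k -> computable N ->
  dec (fun a => osc_test (U a) (x a) (k a) (N a)).
Proof.
move=> hG hU cx ck cN; rewrite /osc_test.
have hJ : carries_jump c by exists G.
do 3!(apply: dec_ex; first leaf).
have hG3 : carries (c := ext (ext (ext c))) (s := ty2) (fun=> G).
  exact: (carries_weak (carries_weak (carries_weak hG))).
have cx3 : computable (c := ext (ext (ext (ext c)))) (fun p => x p.1.1.1.1 p.2).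
  apply: (@comp_under (ext (ext c)) (fun q => x q.1.1)).
  apply: (@comp_under (ext c) (fun q => x q.1)).
  exact: comp_under.
do !apply: dec_and; try (apply: dec_not); try (apply: dec_or).
- comp.
- comp.
- comp.
- comp.
- by apply: dec_exceeds_at => //; comp.
- comp.
- by apply: dec_exceeds_at => //; comp.
- by apply: (dec_exceeds (c := ext (ext (ext c))) (U := fun a => U a.1.1.1)) => //; comp.
- by apply: (dec_exceeds (c := ext (ext (ext c))) (U := fun a => U a.1.1.1)) => //; comp.
Qed.

Definition cont_ctx : ctx := @Ctx (inputs * interp ty1)
  (fun a => [:: Obj G; Obj a.1.1; Obj a.1.2; Obj a.2]) 4 (fun=> erefl).

Lemma continuity_decidable_of_exceeds D : continuity_decidable G rep D.
Proof.
have hG : carries (c := cont_ctx) (s := ty2) (fun=> G) by exists 0%N.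
have hJ : carries_jump cont_ctx by exists G.
have hU : carries (c := cont_ctx) (s := T) (fun a => a.1.2) by exists 2%N.
have hx : carries (c := cont_ctx) (s := ty1) (fun a => a.2) by exists 3%N.
have [e he] : dec (c := cont_ctx) (fun a => forall k, exists N, osc_test a.1.2 a.2 k N).
  apply: dec_all => //; apply: dec_ex; first leaf.
  apply: (dec_osc_test (c := ext (ext cont_ctx)) (U := fun a => a.1.1.1.2)
    (x := fun a => a.1.1.2)).
  - exact: (carries_weak (carries_weak hG)).
  - exact: (carries_weak (carries_weak hU)).
  - apply: (comp_ap1 (c := ext (ext (ext cont_ctx))) (F := fun p => p.1.1.1.2)).
      exact: (carries_weak (carries_weak (carries_weak hx))).
    leaf.
  - leaf.
  - leaf.
exists e => f F U _ Ff Uf x r Ir xr.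
have := he (F, U, x); congr (kleene _ _ (if _ then _ else _)).
apply: asbool_equiv_eq; rewrite (cont_oscillation f Ir) /=.
by split=> h k; have [N hN] := h k; exists N; apply/(osc_testP _ _ Uf xr).
Qed.

Definition mod_ctx : ctx := @Ctx (inputs * interp ty1 * nat)
  (fun a => [:: Obj G; Obj a.1.1.1; Obj a.1.1.2; Obj a.1.2; num a.2]) 5 (fun=> erefl).

Lemma modulus_computable_of_exceeds D : modulus_computable G rep D.
Proof.
have hG : carries (c := mod_ctx) (s := ty2) (fun=> G) by exists 0%N.
have hJ : carries_jump mod_ctx by exists G.
have hU : carries (c := mod_ctx) (s := T) (fun a => a.1.1.2) by exists 2%N.
have hx : carries (c := mod_ctx) (s := ty1) (fun a => a.1.2) by exists 3%N.
have ck : computable (c := mod_ctx) (fun a => a.2) by apply: comp_num; exists 4%N.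
have [e he] : computable (c := mod_ctx) (fun a => least (osc_test a.1.1.2 a.1.2 a.2)).
  apply: comp_least => //.
  apply: (dec_osc_test (c := ext mod_ctx) (U := fun a => a.1.1.1.2)
    (x := fun a => a.1.1.2)).
  - exact: (carries_weak hG).
  - exact: (carries_weak hU).
  - apply: (comp_ap1 (c := ext (ext mod_ctx)) (F := fun p => p.1.1.1.2)).
      exact: (carries_weak (carries_weak hx)).
    leaf.
  - exact: (comp_weak ck).
  - leaf.
exists e => f F U _ Ff Uf _; exists (fun r k => least (oscillation f r k)); split.
  move=> k r y cr Iy ry; have Ir : I01 r := cr.1.
  have [N hN] := proj1 (cont_oscillation f Ir) cr k.
  exact: oscillation_lt (leastP hN) Ir Iy ry.
move=> x r xr k; have := he (F, U, x, k); congr (kleene _ _ (least _)).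
by apply/funext => N; apply/propext; apply: osc_testP.
Qed.

End FromValueQueries.

Theorem theorem2p9 (R : realType) :
  sup_computable E2 (@baire1_rep R) (@I01_valued R)
  /\ continuity_decidable E2 (@baire1_rep R) setT
  /\ modulus_computable E2 (@baire1_rep R) setT
  /\ sup_computable Suslin2 (@baire2_rep R) (@I01_valued R)
  /\ continuity_decidable Suslin2 (@baire2_rep R) (@I01_valued R)
  /\ modulus_computable Suslin2 (@baire2_rep R) setT.
Proof.
have E2_jumps : jumps E2 by left.
have Suslin2_jumps : jumps Suslin2 by right.
have dec1 (c : ctx) U s (p q b : c -> rat) : carries (s := ty2) (fun _ : c => E2) ->
    carries U -> rcomputable p -> rcomputable q -> rcomputable b ->
    dec (fun a => exceeds1 (U a) s (p a) (q a) (b a)).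
  by move=> hE; apply: dec_exceeds1; exists E2.
split; first exact: sup_computable_of_exceeds E2_jumps dec1 (@exceeds1P R).
split; first exact: continuity_decidable_of_exceeds E2_jumps dec1 (@exceeds1P R) _.
split; first exact: modulus_computable_of_exceeds E2_jumps dec1 (@exceeds1P R) _.
split; first exact: sup_computable_of_exceeds Suslin2_jumps dec_exceeds2 (@exceeds2P R).
split; first exact: continuity_decidable_of_exceeds Suslin2_jumps dec_exceeds2 (@exceeds2P R) _.
exact: modulus_computable_of_exceeds Suslin2_jumps dec_exceeds2 (@exceeds2P R) _.
Qed.
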